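(* Let $\mathcal{X}=\mathcal{X}_1\times\cdots\times\mathcal{X}_n$ be a finite product space with a probability distribution $\pi$ on it, and let $\mathsf{P}=\mathsf{P}_n\cdots\mathsf{P}_1$ denote the transition matrix of the systematic scan with the identity permutation. Then $$\gamma_{\mathsf{P}}\le\widetilde{\gamma_{\mathsf{P}}}\le\sqrt{2n\gamma_{\mathsf{P}}}.$$
   Context: For $i\in\{1,\dots,n\}$, $\mathsf{P}_i$ is the Markov kernel that rerandomizes the $i$-th coordinate according to the conditional distribution of $\pi$ given all other coordinates; it acts on functions by $\mathsf{P}_i f(x)=\mathbb{E}_{X\sim\pi}[f(X)\mid X_{-i}=x_{-i}]$, where $x_{-i}$ is the restriction of $x$ to the coordinates other than $i$. The chain is considered on the support of $\pi$, which is assumed to contain at least two points. On real-valued functions, $\langle f,g\rangle_\pi=\sum_x f(x)g(x)\pi(x)$ and $\|f\|_\pi=\sqrt{\langle f,f\rangle_\pi}$. For a transition matrix $\mathsf{P}$ with stationary distribution $\pi$, define $$\|\mathsf{P}\|_{\pi,\mathsf{op}}=\max_{f\ne0:\,\mathbb{E}_\pi[f]=0}\frac{\|\mathsf{P}f\|_\pi}{\|f\|_\pi},\qquad \gamma_{\mathsf{P}}=1-\|\mathsf{P}\|_{\pi,\mathsf{op}},\qquad \widetilde{\gamma_{\mathsf{P}}}=\min_{f\ne0:\,\mathbb{E}_\pi[f]=0}\frac{\|(I-\mathsf{P})f\|_\pi}{\|f\|_\pi}.$$ *)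

(* Defs.v *)
From HB Require Import structures.
From mathcomp Require Import all_boot all_order all_algebra.
From mathcomp Require Import all_classical all_reals.

Set Implicit Arguments.
Unset Strict Implicit.
Unset Printing Implicit Defensive.

Import Order.TTheory GRing.Theory Num.Theory.
Local Open Scope ring_scope.

(* A chain on m states: its law is a row vector of masses, functions on the
   states are column vectors, and the transition matrix P acts by f |-> P *m f. *)
Section Gaps.
Variables (R : realType) (m : nat) (mu : 'rV[R]_m).

Definition mean (f : 'cV[R]_m) : R := \sum_(a < m) f a 0 * mu 0 a.

Definition inner (f g : 'cV[R]_m) : R := \sum_(a < m) f a 0 * g a 0 * mu 0 a.

Definition pinorm (f : 'cV[R]_m) : R := Num.sqrt (inner f f).

Definition mean_zero : set 'cV[R]_m := [set f | f != 0 /\ mean f = 0].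

(* When m >= 2 and all masses are positive, the supremum and the infimum below
   are a maximum and a minimum: the quotients are continuous and invariant under
   scaling, and the unit sphere of the mean-zero functions is compact. *)
Definition opnorm (P : 'M[R]_m) : R :=
  sup [set pinorm (P *m f) / pinorm f | f in mean_zero].

Definition gap (P : 'M[R]_m) : R := 1 - opnorm P.

Definition gap_tilde (P : 'M[R]_m) : R :=
  inf [set pinorm ((1%:M - P) *m f) / pinorm f | f in mean_zero].

End Gaps.

Section FiniteDistribution.
Variables (R : realType) (T : finType) (pi : T -> R).

Definition is_distribution : Prop :=
  (forall x, 0 <= pi x) /\ \sum_x pi x = 1.

Definition supp : {set T} := [set x | 0 < pi x].

(* The law pi read on its support, whose points are numbered by [enum_val]. *)
Definition supp_law : 'rV[R]_#|supp| := \row_a pi (enum_val a).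

Definition prob (A : {set T}) : R := \sum_(x in A) pi x.

Definition cond_prob (A B : {set T}) : R := prob (A :&: B) / prob B.

Definition cond_expect (f : T -> R) (B : {set T}) : R :=
  (\sum_(x in B) f x * pi x) / prob B.

End FiniteDistribution.

Section SystematicScan.
Variables (R : realType) (n : nat) (X : 'I_n -> finType).
Local Notation state := {dffun forall i : 'I_n, X i}.
Variable pi : state -> R.

(* The event X_{-i} = x_{-i}. *)
Definition same_off (i : 'I_n) (x : state) : {set state} :=
  [set y : state | [forall j, (j != i) ==> (y j == x j)]].

Definition rerandomize (i : 'I_n) : 'M[R]_#|supp pi| :=
  \matrix_(a, b) cond_prob pi [set enum_val b] (same_off i (enum_val a)).

Lemma rerandomizeE (i : 'I_n) (f : state -> R) (a : 'I_#|supp pi|) :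
  is_distribution pi ->
  (rerandomize i *m (\col_b f (enum_val b))) a 0 =
  cond_expect pi f (same_off i (enum_val a)).
Proof.
case=> pi_ge0 _; set B := same_off i _.
transitivity (\sum_(y in supp pi) cond_prob pi [set y] B * f y).
  by rewrite big_enum_val mxE; apply: eq_bigr => b _; rewrite !mxE.
rewrite /cond_expect mulr_suml big_mkcond [RHS]big_mkcond /=.
apply: eq_bigr => y _; rewrite inE lt0r pi_ge0 andbT.
have [-> | _] /= := eqVneq (pi y) 0; first by rewrite mulr0 mul0r if_same.
rewrite /cond_prob {1}/prob; case: ifP => yB.
  by rewrite (finset.setIidPl _) ?finset.sub1set// finset.big_set1 mulrC mulrA.
rewrite big1 ?mul0r// => z; rewrite !inE => /andP[/eqP-> zB].
by rewrite /B inE zB in yB.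
Qed.

(* The first factor of the product is the leftmost one, so this is
   P_n *m ... *m P_1. *)
Definition systematic_scan : 'M[R]_#|supp pi| :=
  \prod_(k < n) rerandomize (rev_ord k).

End SystematicScan.

(* Main.v *)
Require Import Defs.
From mathcomp Require Import all_boot all_order all_algebra.
From mathcomp Require Import all_classical all_reals.
From mathcomp Require Import ring lra.

Import Order.TTheory GRing.Theory Num.Theory.
Local Open Scope ring_scope.

(** Each kernel [rerandomize i] is a conditional expectation, hence an orthogonal
    projection of L^2(pi) ([rerandomize_orth_proj]).  Let g_0 = f and let g_k be
    the result of applying the first k projections to f.  Pythagoras gives
    |g_(k-1) - g_k|^2 = |g_(k-1)|^2 - |g_k|^2, so the squared lengths of the n
    steps from f to P f telescope to |f|^2 - |P f|^2, and by convexity of the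
    square ([orth_proj_prod])
      |f - P f|^2 <= n (|f|^2 - |P f|^2).
    With r = |P f| / |f| the right-hand side is n (1 - r^2) |f|^2, which is at
    most 2n (1 - r) |f|^2 because 1 - r^2 = 2 (1 - r) - (1 - r)^2.  For f of mean
    zero the left-hand side is at least gap_tilde^2 |f|^2, so
    r <= 1 - gap_tilde^2 / 2n, and taking the supremum over f gives the upper
    bound on gap_tilde ([gap_tilde_le]).  The lower bound is the triangle
    inequality |f - P f| >= |f| - |P f| ([gap_le]). *)

(** * The inner product weighted by a positive law *)

Section WeightedNorm.
Context {R : realType} {m : nat}.
Variable mu : 'rV[R]_m.
Hypothesis mu_gt0 : forall a, 0 < mu 0 a.
Implicit Types (f g : 'cV[R]_m) (P Q : 'M[R]_m).
Local Notation inner := (inner mu).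
Local Notation pinorm := (pinorm mu).

Lemma innerC f g : inner f g = inner g f.
Proof. by apply: eq_bigr => a _; rewrite [f a 0 * _]mulrC. Qed.

Lemma innerDl f g h : inner (f + g) h = inner f h + inner g h.
Proof. by rewrite -big_split; apply: eq_bigr => a _ /=; rewrite mxE; ring. Qed.

Lemma innerZl c f h : inner (c *: f) h = c * inner f h.
Proof. by rewrite mulr_sumr; apply: eq_bigr => a _; rewrite mxE; ring. Qed.

Lemma innerDr f g h : inner h (f + g) = inner h f + inner h g.
Proof. by rewrite innerC innerDl !(innerC _ h). Qed.

Lemma innerZr c f h : inner h (c *: f) = c * inner h f.
Proof. by rewrite innerC innerZl innerC. Qed.

Lemma inner_ge0 f : 0 <= inner f f.
Proof.
apply: sumr_ge0 => a _; apply: mulr_ge0; last exact: ltW.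
by rewrite -expr2 sqr_ge0.
Qed.

Lemma inner_gt0 f : f != 0 -> 0 < inner f f.
Proof.
case/matrix0Pn => a [j]; rewrite ord1 => fa.
rewrite /Defs.inner (bigD1 a)//= ltr_pwDl//.
  by rewrite mulr_gt0// -expr2 exprn_even_gt0.
apply: sumr_ge0 => b _; apply: mulr_ge0; last exact: ltW.
by rewrite -expr2 sqr_ge0.
Qed.

Lemma sqr_pinorm f : pinorm f ^+ 2 = inner f f.
Proof. by rewrite sqr_sqrtr// inner_ge0. Qed.

Lemma pinorm_ge0 f : 0 <= pinorm f.
Proof. exact: sqrtr_ge0. Qed.

Lemma pinorm_gt0 f : f != 0 -> 0 < pinorm f.
Proof. by move=> f0; rewrite sqrtr_gt0 inner_gt0. Qed.

Lemma pinorm0 : pinorm 0 = 0.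
Proof.
by rewrite /Defs.pinorm /Defs.inner big1 ?sqrtr0// => a _; rewrite mxE !mul0r.
Qed.

Lemma cauchy_schwarz f g : inner f g <= pinorm f * pinorm g.
Proof.
have [->|f0] := eqVneq f 0.
  by rewrite -(scale0r 0) innerZl mul0r scale0r pinorm0 mul0r.
have [->|g0] := eqVneq g 0.
  by rewrite -(scale0r 0) innerZr mul0r scale0r pinorm0 mulr0.
have := inner_ge0 (pinorm g *: f + (- pinorm f) *: g).
rewrite !(innerDl, innerDr, innerZl, innerZr) (innerC g f) -!sqr_pinorm => pos.
have ab : 0 < pinorm f * pinorm g by rewrite mulr_gt0 ?pinorm_gt0.
rewrite -(ler_pM2l ab); lra.
Qed.

Lemma pinorm_triangle f g : pinorm (f + g) <= pinorm f + pinorm g.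
Proof.
rewrite -ler_sqr ?nnegrE ?addr_ge0 ?pinorm_ge0//.
rewrite sqr_pinorm innerDl !innerDr (innerC g f) -!sqr_pinorm.
have := cauchy_schwarz f g; lra.
Qed.

(** * Products of orthogonal projections *)

(** The second clause is detailed balance, that is, self-adjointness of [Q] for
    the inner product weighted by [mu]. *)
Definition orth_proj Q : Prop :=
  Q *m Q = Q /\ forall a b, mu 0 a * Q a b = mu 0 b * Q b a.

Lemma inner_self_adjoint Q f g :
  (forall a b, mu 0 a * Q a b = mu 0 b * Q b a) ->
  inner (Q *m f) g = inner f (Q *m g).
Proof.
move=> Qsym; rewrite /Defs.inner.
under eq_bigr => a _ do rewrite mxE !mulr_suml.
under [RHS]eq_bigr => a _ do rewrite mxE mulr_sumr mulr_suml.
rewrite exchange_big; apply: eq_bigr => a _; apply: eq_bigr => b _ /=.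
transitivity (f a 0 * g b 0 * (mu 0 b * Q b a)); first ring.
rewrite Qsym; ring.
Qed.

Lemma orth_proj_pythagoras Q f : orth_proj Q ->
  inner (f - Q *m f) (f - Q *m f) = inner f f - inner (Q *m f) (Q *m f).
Proof.
case=> QQ Qsym.
have Qf : inner f (Q *m f) = inner (Q *m f) (Q *m f).
  by rewrite inner_self_adjoint// mulmxA QQ.
rewrite -(scaleN1r (Q *m f)) !(innerDl, innerDr, innerZl, innerZr).
rewrite (innerC _ f) Qf; ring.
Qed.

(** The energy lost along the scan controls the displacement: the factor [n]
    comes from bounding the square of a sum of [n] steps by [n] times the sum of
    their squares. *)
Lemma orth_proj_prod n (Q : 'I_n -> 'M[R]_m) f :
  (forall k, orth_proj (Q k)) ->
  let P := \prod_(k < n) Q k in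
  inner (f - P *m f) (f - P *m f) <=
    n%:R * (inner f f - inner (P *m f) (P *m f)).
Proof.
elim: n Q => [|n IHn] Q Qproj /=.
  by rewrite big_ord0 mul1mx subrr mul0r -sqr_pinorm pinorm0 expr0n.
have := IHn (fun k => Q (lift ord0 k)) (fun k => Qproj _).
rewrite big_ord_recl -mulmxE -mulmxA /=; set g := _ *m f => {}IHn.
have gf : n = 0%N -> g = f.
  move=> n0; rewrite /g mulmxE big1 ?mul1mx// => -[k lt_kn].
  by exfalso; rewrite n0 in lt_kn.
have := @orth_proj_pythagoras (Q ord0) g (Qproj _); set h := Q ord0 *m g => uv.
have [n0|n_gt0] := posnP n; first by rewrite n0 mul1r -(gf n0) uv.
have -> : f - h = (f - g) + (g - h) by rewrite addrA subrK.
move: (f - g) (g - h) IHn uv => u v IHn uv.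
have n0 : 0 < n%:R :> R by rewrite ltr0n.
(* (N+1) |u|^2 + N (N+1) |v|^2 - N |u+v|^2 is the square of |u - N v| *)
have := inner_ge0 (u + (- n%:R) *: v).
rewrite !(innerDl, innerDr, innerZl, innerZr) (innerC v u) uv.
move=> square_ge0; rewrite -(ler_pM2l n0) -[n.+1%:R]natr1.
have N1 : 0 < n%:R + 1 :> R by rewrite addr_gt0.
have {}IHn := ler_wpM2l (ltW N1) IHn.
lra.
Qed.

(** * From the energy estimate to the gaps *)

(** The witness is supported on two states; giving each the mass of the other,
    with opposite signs, cancels the mean. *)
Lemma mean_zero_nonempty : (2 <= m)%N -> exists f, mean_zero mu f.
Proof.
move=> m2; pose a := Ordinal (ltnW m2); pose b := Ordinal m2.
have ba : b != a by [].
exists (\col_c (if c == a then mu 0 b else if c == b then - mu 0 a else 0)).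
split.
  by apply/matrix0Pn; exists a, 0; rewrite mxE eqxx lt0r_neq0.
rewrite /mean (bigD1 a)//= (bigD1 b)//= big1 => [|c /andP[/negPf ca /negPf cb]].
  by rewrite !mxE !eqxx (negPf ba); ring.
by rewrite mxE ca cb mul0r.
Qed.

Section Gaps.
Variable P : 'M[R]_m.
Hypothesis m_ge2 : (2 <= m)%N.

(** Contraction bounds the ratios by 1, so that their [sup] is an upper bound
    rather than a default value. *)
Lemma ratio_le_opnorm f :
  (forall g, pinorm (P *m g) <= pinorm g) -> mean_zero mu f ->
  pinorm (P *m f) / pinorm f <= opnorm mu P.
Proof.
move=> P_contr f0; apply: ub_le_sup; last by exists f.
exists 1 => _ [g [g0 _] <-].
by rewrite ler_pdivrMr ?pinorm_gt0// mul1r.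
Qed.

Lemma gap_tilde_le_ratio f : mean_zero mu f ->
  gap_tilde mu P <= pinorm ((1%:M - P) *m f) / pinorm f.
Proof.
move=> f0; apply: ge_inf; last by exists f.
by exists 0 => _ [g _ <-]; rewrite divr_ge0 ?pinorm_ge0.
Qed.

Lemma gap_tilde_ge0 : 0 <= gap_tilde mu P.
Proof.
have [f f0] := mean_zero_nonempty m_ge2.
apply: lb_le_inf; first by exists (pinorm ((1%:M - P) *m f) / pinorm f), f.
by move=> _ [g _ <-]; rewrite divr_ge0 ?pinorm_ge0.
Qed.

Lemma gap_le : (forall f, pinorm (P *m f) <= pinorm f) ->
  gap mu P <= gap_tilde mu P.
Proof.
move=> P_contr; have [f f0] := mean_zero_nonempty m_ge2.
apply: lb_le_inf; first by exists (pinorm ((1%:M - P) *m f) / pinorm f), f.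
move=> _ [g g0 <-]; have gpos := pinorm_gt0 _ g0.1.
apply: (@le_trans _ _ (1 - pinorm (P *m g) / pinorm g)).
  by rewrite lerD2l lerN2 ratio_le_opnorm.
rewrite -[X in X - _](divff (lt0r_neq0 gpos)) -mulrBl.
rewrite ler_wpM2r ?invr_ge0 ?pinorm_ge0// lerBlDr.
by rewrite mulmxBl mul1mx -{1}[g](subrK (P *m g)) pinorm_triangle.
Qed.

Lemma gap_tilde_le (K : R) : 0 < K ->
  (forall f, inner (f - P *m f) (f - P *m f) <=
     K * (inner f f - inner (P *m f) (P *m f))) ->
  gap_tilde mu P <= Num.sqrt (2 * K * gap mu P).
Proof.
move=> K0 energy; set t := gap_tilde mu P; have t0 : 0 <= t := gap_tilde_ge0.
have K2 : 0 < 2 * K by rewrite mulr_gt0.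
suff le : opnorm mu P <= 1 - t ^+ 2 / (2 * K).
  rewrite -(ger0_norm t0) -sqrtr_sqr ler_wsqrtr//.
  by rewrite mulrC -ler_pdivrMr// /gap lerBrDr addrC -lerBrDr.
have [f f0] := mean_zero_nonempty m_ge2.
apply: ge_sup; first by exists (pinorm (P *m f) / pinorm f), f.
move=> _ [g g0 <-]; have gpos := pinorm_gt0 _ g0.1.
have tg : (t * pinorm g) ^+ 2 <= pinorm (g - P *m g) ^+ 2.
  rewrite ler_sqr ?nnegrE ?mulr_ge0 ?pinorm_ge0//.
  have := gap_tilde_le_ratio _ g0.
  by rewrite ler_pdivlMr// mulmxBl mul1mx.
have := energy g; rewrite -!sqr_pinorm.
have := divfK (lt0r_neq0 gpos) (pinorm (P *m g)); set r := _ / _ => <- en.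
have tr : t ^+ 2 <= K * (1 - r ^+ 2).
  have g2 : 0 < pinorm g ^+ 2 by rewrite exprn_gt0.
  rewrite -(ler_pM2r g2) -exprMn (le_trans tg)// (le_trans en)//.
  by rewrite exprMn; lra.
rewrite lerBrDr addrC -lerBrDr ler_pdivrMr//; apply: (le_trans tr).
rewrite -subr_ge0 (_ : _ - _ = K * (1 - r) ^+ 2); last by ring.
by rewrite mulr_ge0 ?sqr_ge0 // ltW.
Qed.

End Gaps.

End WeightedNorm.

(** * Rerandomization is an orthogonal projection *)

Section Rerandomize.
Context {R : realType} {n : nat} {X : 'I_n -> finType}.
Local Notation state := {dffun forall i : 'I_n, X i}.
Variable pi : state -> R.
Hypothesis pi_dist : is_distribution pi.
Implicit Types (i : 'I_n) (x y : state).

Lemma supp_law_gt0 a : 0 < supp_law pi 0 a.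
Proof. by have := enum_valP a; rewrite mxE inE. Qed.

Lemma same_off_refl i x : x \in same_off i x.
Proof. by rewrite inE; apply/forallP => j; rewrite eqxx implybT. Qed.

(** The events [same_off i x] are the classes of an equivalence relation. *)
Lemma same_off_eq i x y : y \in same_off i x -> same_off i y = same_off i x.
Proof.
rewrite inE => /forallP yx; apply/setP => z; rewrite !inE.
apply: eq_forallb => j; have := yx j.
by case: (j != i) => //= /eqP->.
Qed.

Lemma same_off_sym i x y : (y \in same_off i x) = (x \in same_off i y).
Proof.
by apply/idP/idP => /same_off_eq h; rewrite -?h ?same_off_refl// h same_off_refl.
Qed.

Lemma rerandomize_entry i a b :
  rerandomize pi i a b =
    if enum_val b \in same_off i (enum_val a)
    then supp_law pi 0 b / prob pi (same_off i (enum_val a)) else 0.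
Proof.
rewrite mxE /cond_prob {1}/prob; case: ifP => ba.
  by rewrite (finset.setIidPl _) ?finset.sub1set// finset.big_set1 mxE.
rewrite big1 ?mul0r// => z; rewrite !inE => /andP[/eqP-> zB].
by rewrite inE zB in ba.
Qed.

Lemma prob_same_off_gt0 i (a : 'I_#|supp pi|) :
  0 < prob pi (same_off i (enum_val a)).
Proof.
rewrite /prob (bigD1 (enum_val a)) ?same_off_refl//= ltr_pwDl//.
  by have := enum_valP a; rewrite inE.
by apply: sumr_ge0 => y _; case: pi_dist => + _; apply.
Qed.

Lemma rerandomize_row_sum i a : \sum_b rerandomize pi i a b = 1.
Proof.
have := rerandomizeE i (fun=> 1) a pi_dist; rewrite mxE /cond_expect.
under eq_bigr => b _ do rewrite [X in _ * X]mxE mulr1.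
under [in RHS]eq_bigr => y _ do rewrite mul1r.
by move->; rewrite divff// lt0r_neq0// prob_same_off_gt0.
Qed.

(** Row [a] depends only on the class of [a] and is supported in that class, so
    row [a] of the square is an average of rows all equal to row [a]. *)
Lemma rerandomize_orth_proj i : orth_proj (supp_law pi) (rerandomize pi i).
Proof.
split=> [|a b]; last first.
  rewrite !rerandomize_entry [in RHS]same_off_sym.
  case: ifP => [/same_off_eq->|_]; last by rewrite !mulr0.
  by ring.
apply/matrixP => a c; rewrite mxE.
rewrite -[RHS]mul1r -(rerandomize_row_sum i a) mulr_suml.
apply: eq_bigr => b _; rewrite [X in X * _]rerandomize_entry.
rewrite [X in _ = X * _]rerandomize_entry.
case: ifP => [/same_off_eq ba|_]; last by rewrite !mul0r.
by rewrite !(rerandomize_entry i _ c) ba.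
Qed.

End Rerandomize.

Theorem lemma2p1 (R : realType) (n : nat) (X : 'I_n -> finType)
    (pi : {dffun forall i : 'I_n, X i} -> R)
    (pi_dist : is_distribution pi)
    (supp_ge2 : (2 <= #|supp pi|)%N) :
  let P := systematic_scan pi in
  let mu := supp_law pi in
  gap mu P <= gap_tilde mu P
  /\ gap_tilde mu P <= Num.sqrt (2 * n%:R * gap mu P).
Proof.
move=> P mu; have mu_gt0 : forall a, 0 < mu 0 a := supp_law_gt0 pi.
(* the product over an empty index set has a single point *)
have n_gt0 : (0 < n)%N.
  clear P mu mu_gt0 pi_dist; case: n X pi supp_ge2 => // X pi.
  by case/card_gt1P => x [y [_ _ /eqP[]]]; apply/ffunP; case.
have n0 : 0 < n%:R :> R by rewrite ltr0n.
have energy f : inner mu (f - P *m f) (f - P *m f) <=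
    n%:R * (inner mu f f - inner mu (P *m f) (P *m f)).
  by apply: orth_proj_prod => // k; apply: rerandomize_orth_proj.
have contr f : pinorm mu (P *m f) <= pinorm mu f.
  rewrite ler_wsqrtr// -subr_ge0 -(pmulr_rge0 _ n0).
  exact: le_trans (inner_ge0 _ mu_gt0 _) (energy f).
by split; [apply: gap_le | apply: gap_tilde_le].
Qed.
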